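(* Let $p,q,r,a,b,c$ be even integers and let $\tau$ be a transposition in the symmetric group on three letters, so that $(\tau(a),\tau(b),\tau(c))$ is one of $(b,a,c)$, $(a,c,b)$, $(c,b,a)$. Then $$J_{K\left(\begin{smallmatrix} p & q & r\\ a & b & c\end{smallmatrix}\right)}=J_{K\left(\begin{smallmatrix} p & q & r\\ \tau(a) & \tau(b) & \tau(c)\end{smallmatrix}\right)}$$ if and only if $$K\left(\begin{smallmatrix} p & q & r\\ a & b & c\end{smallmatrix}\right)=K\left(\begin{smallmatrix} p & q & r\\ \tau(a) & \tau(b) & \tau(c)\end{smallmatrix}\right)$$ by a $D_3$ symmetry.
   Context: Twist regions. Let $e$ be an arc (an edge) in $S^2$ with two disjoint strands running parallel to $e$, one on each side. To put the integer label $n$ on $e$ means to twist these two strands about $e$ by $|n|$ half twists, producing a row of $|n|$ crossings along $e$ (none if $n=0$), all of sign $\operatorname{sign}(n)$ relative to $e$. A crossing is positive relative to $e$ if, when the picture (with $S^2$ viewed from a fixed side) is rotated locally so that $e$ is vertical, the overcrossing strand runs from upper left to lower right; it is negative if the overcrossing strand runs from lower left to upper right. The diagram $K\left(\begin{smallmatrix} p & q & r\\ a & b & c\end{smallmatrix}\right)$, for integers $p,q,r,a,b,c$. Divide a circle $C\subset S^2$ into six arcs $A_1,B_1,A_2,B_2,A_3,B_3$ in this cyclic order. In one complementary disk of $C$ (the inside) take a Y-shaped tree $T$ with one trivalent vertex and three legs ending at interior points of $A_1,A_2,A_3$, and three disjoint strands forming the boundary of a thin neighborhood of $T$, the $i$-th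 strand joining the two endpoints of $B_i$; two strands run along each leg. Put labels $p,q,r$ on the legs ending at $A_1,A_2,A_3$, respectively. In the other disk (the outside) take a Y-shaped tree $T'$ with legs ending at interior points of $B_1,B_2,B_3$ and three strands forming the boundary of a thin neighborhood of $T'$, the $i$-th strand joining the two endpoints of $A_i$; put labels $a,b,c$ on the legs ending at $B_1,B_2,B_3$, respectively. The union is the link diagram $K\left(\begin{smallmatrix} p & q & r\\ a & b & c\end{smallmatrix}\right)$. When all six labels are even it presents a knot. Equality of knots means ambient isotopy in $S^3$. $D_3$ symmetry. Two such knots are equal by a $D_3$ symmetry if their label arrays are interchangeable by repeated use of the following relations, realized by isotopies: the rotations $K\left(\begin{smallmatrix} p & q & r\\ a & b & c\end{smallmatrix}\right)=K\left(\begin{smallmatrix} q & r & p\\ b & c & a\end{smallmatrix}\right)=K\left(\begin{smallmatrix} r & p & q\\ c & a & b\end{smallmatrix}\right)$ and the reflection $K\left(\begin{smallmatrix} p & q & r\\ a & b & c\end{smallmatrix}\right)=K\left(\begin{smallmatrix} p & r & q\\ c & b & a\end{smallmatrix}\right)$. $J_K$ is the Jones polynomial of $K$. *)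

(* Defs.v *)
From Stdlib Require Import Relation_Operators.
From HB Require Import structures.
From mathcomp Require Import all_boot all_order all_algebra.

Set Implicit Arguments.
Unset Strict Implicit.
Unset Printing Implicit Defensive.

Import Order.TTheory GRing.Theory Num.Theory.
Local Open Scope ring_scope.

(* Planar diagram codes.  [X i j k l] is a crossing whose four edges, read
   counterclockwise, are i, j, k, l, with i and k on the under-strand (so j and
   l are on the over-strand).  A pair (i, j) in [joins] glues an end of i to an
   end of j without a crossing.  Every edge should fill exactly two of the
   slots of [crossings] and [joins]; joins make it possible to represent
   components without crossings. *)
Record crossing (E : Type) := X { xi : E; xj : E; xk : E; xl : E }.

Record diagram (E : Type) :=
  Diagram { crossings : seq (crossing E); joins : seq (E * E) }.

(* Kauffman bracket and Jones polynomial.  Laurent polynomials in t^(1/4) live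
   in the fraction field of Z[t^(1/4)]; the indeterminate 'X stands for t^(1/4),
   and Kauffman's variable is A = t^(-1/4). *)
Definition laurent := {fraction {poly int}}.

Definition varA : laurent := (tofrac 'X)^-1.

Definition loop_value : laurent := - varA ^+ 2 - varA ^- 2.

Definition joined (E : eqType) (js : seq (E * E)) : rel E :=
  fun e f => ((e, f) \in js) || ((f, e) \in js).

(* Number of closed curves of a diagram without crossings. *)
Definition loops (E : finType) (js : seq (E * E)) : nat :=
  n_comp (joined js) E.

(* <X i j k l> = A <i~j, k~l> + A^-1 <j~k, l~i>, normalized by <unknot> = 1.
   The A-smoothing opens the two regions swept by the over-strand when it is
   turned counterclockwise. *)
Fixpoint bracket_rec (E : finType) (xs : seq (crossing E)) (js : seq (E * E))
    : laurent :=
  if xs is X i j k l :: xs' then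
    varA * bracket_rec xs' [:: (i, j), (k, l) & js]
    + varA^-1 * bracket_rec xs' [:: (j, k), (l, i) & js]
  else loop_value ^+ (loops js).-1.

Definition bracket (E : finType) (D : diagram E) : laurent :=
  bracket_rec (crossings D) (joins D).

(* A choice of directions.  At [X i j k l], the first boolean says that the
   under-strand runs from i to k, the second one that the over-strand runs from
   j to l; at a join (i, j) the boolean says that the strand runs from i to j. *)
Definition directions (E : Type) (D : diagram E) : finType :=
  ((size (crossings D)).-tuple (bool * bool) *
   (size (joins D)).-tuple bool)%type.

Definition directed (E : Type) (forward : bool) (e f : E) : E * E :=
  if forward then (e, f) else (f, e).

Definition directed_strands (E : Type) (D : diagram E) (o : directions D)
    : seq (E * E) :=
  flatten [seq [:: directed y.2.1 (xi y.1) (xk y.1);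
                   directed y.2.2 (xj y.1) (xl y.1)]
          | y <- zip (crossings D) o.1]
  ++ [seq directed y.2 y.1.1 y.1.2 | y <- zip (joins D) o.2].

(* The directions are coherent when every edge is left as often as entered. *)
Definition orientation (E : eqType) (D : diagram E) (o : directions D) : bool :=
  perm_eq (unzip1 (directed_strands o)) (unzip2 (directed_strands o)).

(* When the under-strand runs from i to k, the crossing is positive (in the
   usual right-handed sense) if the over-strand runs from l to j. *)
Definition crossing_sign (o : bool * bool) : int := if o.1 == o.2 then -1 else 1.

(* A knot diagram has two orientations, opposite to one another, and they have
   the same writhe; so for knots the choice made here is immaterial. *)
Definition writhe (E : finType) (D : diagram E) : int :=
  if [pick o : directions D | orientation o] is Some o
  then \sum_(s <- (o.1 : seq (bool * bool))) crossing_sign s else 0.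

Definition Jones (E : finType) (D : diagram E) : laurent :=
  (- varA ^+ 3) ^ (- writhe D) * bracket D.

(* ((p, q, r), (a, b, c)) is the array with rows p q r and a b c. *)
Definition labels := ((int * int * int) * (int * int * int))%type.

(* The six legs are indexed by 'I_6 in the cyclic order A_1, B_1, ..., B_3 of
   the arcs where they end: the even ones are inside C, the odd ones outside. *)
Definition leg_label (L : labels) (j : 'I_6) : int :=
  let: ((p, q, r), (a, b, c)) := L in nth 0 [:: p; a; q; b; r; c] j.

Definition leg_size (L : labels) (j : 'I_6) : nat := `|leg_label L j|%N.

(* The |n| crossings of a leg labelled n cut each of its two strands into
   |n| + 1 edges, numbered from the trivalent vertex (0) to C (|n|).  The boolean
   is true for the edges on the left of the leg when it is rotated so that it
   points upwards from the trivalent vertex to C. *)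
Definition edge (L : labels) : finType :=
  {j : 'I_6 & ('I_(leg_size L j).+1 * bool)%type}.

Definition mk_edge (L : labels) (j : 'I_6) (k : nat) (left : bool) : edge L :=
  @Tagged 'I_6 j (fun j => ('I_(leg_size L j).+1 * bool)%type) (inord k, left).

(* The k-th crossing of leg j, whose lower edges are numbered k and whose upper
   edges are numbered k + 1.  For a positive label the over-strand runs from
   upper left to lower right, otherwise from lower left to upper right. *)
Definition leg_crossing (L : labels) (j : 'I_6) (k : nat) : crossing (edge L) :=
  let bl := mk_edge L j k true in
  let br := mk_edge L j k false in
  let tl := mk_edge L j k.+1 true in
  let tr := mk_edge L j k.+1 false in
  if 0 < leg_label L j then X bl br tr tl else X br tr tl bl.

Definition leg_crossings (L : labels) (j : 'I_6) : seq (crossing (edge L)) :=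
  [seq leg_crossing L j k | k <- iota 0 (leg_size L j)].

(* With the inside drawn as the bounded disk, the arcs follow one another
   counterclockwise (the clockwise convention gives the same diagram seen from
   the other side of the sphere, hence the same knot).  Looking along a leg
   towards C, the arc where it ends is traversed from right to left for a
   leg inside C (j even) and from left to right for a leg outside C (j odd).
   [first_edge L j k] and [last_edge L j k] are the k-th edges of leg j on the
   side where this arc begins and on the side where it ends. *)
Definition first_edge (L : labels) (j : 'I_6) (k : nat) : edge L :=
  mk_edge L j k (odd j).

Definition last_edge (L : labels) (j : 'I_6) (k : nat) : edge L :=
  mk_edge L j k (~~ odd j).

(* The arcs of legs j and j + 1 (mod 6) share an endpoint on C, where strands of
   these legs meet.  Around the trivalent vertex of T or T', leg j is followed by
   leg j + 2, and one of the three strands at that vertex passes from the last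
   side of leg j to the first side of leg j + 2. *)
Definition leg_joins (L : labels) (j : 'I_6) : seq (edge L * edge L) :=
  [:: (last_edge L j (leg_size L j), first_edge L (j + 1) (leg_size L (j + 1)));
      (last_edge L j 0, first_edge L (j + 2%:R) 0)].

Definition K (L : labels) : diagram (edge L) :=
  Diagram (flatten [seq leg_crossings L j | j <- enum 'I_6])
          (flatten [seq leg_joins L j | j <- enum 'I_6]).

Inductive D3_step : labels -> labels -> Prop :=
| D3_rotation1 p q r a b c :
    D3_step ((p, q, r), (a, b, c)) ((q, r, p), (b, c, a))
| D3_rotation2 p q r a b c :
    D3_step ((p, q, r), (a, b, c)) ((r, p, q), (c, a, b))
| D3_reflection p q r a b c :
    D3_step ((p, q, r), (a, b, c)) ((p, r, q), (c, b, a)).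

Definition D3_symmetric : labels -> labels -> Prop :=
  clos_refl_sym_trans labels D3_step.

(* Main.v *)
(** Each leg labelled [n] is a twist region: its bracket expansion is a kept
    state (the two strands run along the leg) with coefficient [x n] plus a cut
    state (the leg is severed) with coefficient [y n].  So each side of [C]
    becomes a combination of the five crossingless matchings of the six points
    where the arcs meet; gluing the two sides gives an explicit polynomial in
    the [x]'s and [y]'s.  The only part of it that is not symmetric in [a, b, c]
    is [(d ^ 2 - 1) * sum_i I_i * O_i], where [I_i] and [O_i] are the
    coefficients of the three matchings in which one leg is cut.  Hence a
    transposition changes the bracket by
    [(d ^ 2 - 1) * (I_i - I_j) * (O_i - O_j)], which vanishes only if two labels
    of the same row coincide, since [y n / x n] determines [n]; and then the
    transposition is a [D_3] symmetry.  With even labels the strands of each leg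
    are antiparallel, so the writhe is the sum of the labels and is not changed
    by the transposition. *)
Require Import Defs.
From Stdlib Require Import Relation_Operators.
From mathcomp Require Import all_boot all_order all_algebra.
From mathcomp Require Import ring zify.

Set Implicit Arguments.
Unset Strict Implicit.
Unset Printing Implicit Defensive.

Import Order.TTheory GRing.Theory Num.Theory.
Local Open Scope ring_scope.

(** * Joins and the Kauffman bracket *)

Lemma joined_sym (E : eqType) (js : seq (E * E)) : symmetric (joined js).
Proof. by move=> x y; rewrite /joined orbC. Qed.

Lemma connect_joined_sym (E : finType) (js : seq (E * E)) :
  connect_sym (joined js).
Proof. exact/sym_connect_sym/joined_sym. Qed.

Lemma connect_join (E : finType) (js : seq (E * E)) x y :
  (x, y) \in js -> connect (joined js) x y.
Proof. by move=> xy; rewrite connect1 // /joined xy. Qed.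

Lemma connect_join_sym (E : finType) (js : seq (E * E)) x y :
  (y, x) \in js -> connect (joined js) x y.
Proof. by rewrite connect_joined_sym; apply: connect_join. Qed.

Lemma connect_image (E F : finType) (g : E -> F) js js' :
    (forall p, p \in js -> connect (joined js') (g p.1) (g p.2)) ->
  forall x y, connect (joined js) x y -> connect (joined js') (g x) (g y).
Proof.
move=> gP x _ /connectP[p pP ->]; elim: p x pP => //= y p IHp x /andP[xy /IHp].
apply: connect_trans; case/orP: xy => /gP //=; by rewrite connect_joined_sym.
Qed.

Section Equivalence.

Variables (E F : finType) (g : E -> F) (s : F -> E).

(** [g] and [s] are mutually inverse up to connectedness, so they induce a bijection between the
    closed curves. Neither map need be injective, which allows edges to be contracted. *)
Definition join_equiv (js : seq (E * E)) (js' : seq (F * F)) : Prop :=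
  [/\ forall p, p \in js -> connect (joined js') (g p.1) (g p.2),
      forall p, p \in js' -> connect (joined js) (s p.1) (s p.2),
      forall x, connect (joined js) x (s (g x))
    & forall z, connect (joined js') z (g (s z))].

Lemma loops_equiv js js' : join_equiv js js' -> loops js = loops js'.
Proof.
case=> gP sP sgP gsP; have sym := connect_joined_sym.
have closedT : closed (joined js) (mem E) by [].
rewrite /loops (adjunction_n_comp s (sym _ js) (sym _ js') closedT).
  exact: eq_n_comp_r.
split=> [x _|x' y' _]; first by exists (g x).
apply/idP/idP; first exact: connect_image.
move=> /(connect_image gP) gs; apply: connect_trans (gsP x') _.
by apply: connect_trans gs _; rewrite sym.
Qed.

Definition map_join (p : E * E) : F * F := (g p.1, g p.2).

Definition map_crossing (x : crossing E) : crossing F :=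
  X (g (xi x)) (g (xj x)) (g (xk x)) (g (xl x)).

Lemma join_equiv_cons p js js' :
  join_equiv js js' -> join_equiv (p :: js) (map_join p :: js').
Proof.
have sub (T : finType) (q : T * T) (ks : seq (T * T)) x y :
    connect (joined ks) x y -> connect (joined (q :: ks)) x y.
  apply: (connect_image (g := id)) => r r_ks.
  by apply: connect_join; rewrite inE -surjective_pairing r_ks orbT.
have head (T : finType) (q : T * T) (ks : seq (T * T)) :
    connect (joined (q :: ks)) q.1 q.2.
  by apply: connect_join; rewrite -surjective_pairing mem_head.
case=> gP sP sgP gsP; split=> [q|q|x|z]; rewrite ?inE.
- by case/predU1P=> [->|/gP/sub->] //; exact: (head _ (map_join p)).
- case/predU1P=> [->|/sP/sub->] //=.
  apply: connect_trans (sub _ _ _ _ _ (sgP p.2)); rewrite connect_joined_sym.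
  by apply: connect_trans (sub _ _ _ _ _ (sgP p.1)); rewrite connect_joined_sym.
- exact/sub/sgP.
- exact/sub/gsP.
Qed.

(** Smoothing a crossing adds joins with corresponding ends on both sides, which keeps the
    equivalence; at the leaves only the number of loops matters. *)
Lemma bracket_equiv xs js js' :
  join_equiv js js' -> bracket_rec xs js = bracket_rec (map map_crossing xs) js'.
Proof.
elim: xs js js' => [|[i j k l] xs IHxs] js js' eq_js /=.
  by rewrite (loops_equiv eq_js).
by congr (_ * _ + _ * _); apply: IHxs; do 2!apply: join_equiv_cons.
Qed.

End Equivalence.

Definition crossing_in (E : Type) (Q : pred E) (x : crossing E) : bool :=
  [&& Q (xi x), Q (xj x), Q (xk x) & Q (xl x)].

Definition join_in (E : Type) (Q : pred E) (p : E * E) : bool :=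
  Q p.1 && Q p.2.

Lemma eq_map_crossing (E F : finType) (g h : E -> F) (Q : pred E) xs :
    (forall e, Q e -> g e = h e) -> all (crossing_in Q) xs ->
  map (map_crossing g) xs = map (map_crossing h) xs.
Proof.
move=> eq_gh; elim: xs => //= [[i j k l] xs IHxs] /andP[xQ /IHxs->].
by case/and4P: xQ => /= Qi Qj Qk Ql; rewrite /map_crossing /= !eq_gh.
Qed.

Lemma map_crossing_id (E : finType) (xs : seq (crossing E)) :
  map (map_crossing id) xs = xs.
Proof. by elim: xs => //= [[i j k l] xs ->]. Qed.

Lemma eq_bracket_rec (E : finType) (xs : seq (crossing E)) js js' :
  joined js =2 joined js' -> bracket_rec xs js = bracket_rec xs js'.
Proof.
move=> eq_js; rewrite (@bracket_equiv E E id id xs js js') ?map_crossing_id //.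
have eq_c := eq_connect eq_js.
by split=> // -[x y] /connect_join /=; rewrite eq_c.
Qed.

Section ExtraLoop.

Variable E : finType.

Lemma joined_Some (js : seq (E * E)) x y :
  joined (map (map_join Some) js) (Some x) (Some y) = joined js x y.
Proof.
have inj : injective (map_join (@Some E)) by move=> [? ?] [? ?] [-> ->].
by rewrite /joined -!(mem_map inj).
Qed.

Lemma loops_Some (js : seq (E * E)) :
  loops (map (map_join Some) js) = (loops js).+1.
Proof.
set js' := map _ js; have sym := connect_joined_sym.
have noneF x : joined js' None (Some x) = false.
  by apply/negP => /orP[] /mapP[].
have cl : closed (joined js') [pred z | z != None].
  by case=> [x|] [y|] //; rewrite ?noneF // joined_sym noneF.
(* The class of [None] is split off: the other points form a copy of [E], and [None] is alone in its
   class. *)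
rewrite /loops (n_compC [pred z | z != None]) addnC.
rewrite (adjunction_n_comp Some (sym _ js') (sym _ js) cl); last first.
  split=> [[x|] // _|x y _]; first by exists x.
  apply/idP/idP; first by apply: connect_image => p p_js; apply: connect_join;
    apply/mapP; exists p.
  case/connectP=> p; elim: p x => [|[z|] p IHp] x /=.
  - by move=> _ [->].
  - rewrite joined_Some => /andP[xz pP] py.
    exact: connect_trans (connect1 xz) (IHp _ pP py).
  - by rewrite joined_sym noneF.
rewrite (@eq_n_comp_r _ _ _ (connect (joined js') None)).
  by rewrite n_comp_connect //; congr _.+1; apply: eq_n_comp_r.
move=> [x|]; rewrite !inE ?connect0 //=; apply/esym/negP => /connectP[[|[y|] p]] //=.
  by rewrite noneF.
elim: p => //= [[y|] p IHp] //=; first by rewrite noneF !andbF.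
by move=> /and3P[? ? ?] e; apply: IHp => //; apply/andP.
Qed.

(** The isolated point [None] is a circle disjoint from the diagram. The edge [e0] guarantees at
    least one other loop, so that the truncated predecessor in the exponent really drops by one. *)
Lemma bracket_rec_Some (e0 : E) (xs : seq (crossing E)) js :
  bracket_rec (map (map_crossing Some) xs) (map (map_join Some) js)
  = loop_value * bracket_rec xs js.
Proof.
elim: xs js => [|[i j k l] xs IHxs] js /=; last first.
  by rewrite mulrDr !(mulrCA loop_value) -!IHxs.
rewrite loops_Some /= -exprS prednK //.
by apply/card_gt0P; exists (fingraph.root (joined js) e0); rewrite inE /= roots_root //;
  exact: connect_joined_sym.
Qed.

End ExtraLoop.

Lemma eq_mem_bracket_rec (E : finType) (xs : seq (crossing E)) js js' :
  js =i js' -> bracket_rec xs js = bracket_rec xs js'.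
Proof. by move=> eq_js; apply: eq_bracket_rec => x y; rewrite /joined !eq_js. Qed.

Lemma bracket_rec_flip (E : finType) (xs : seq (crossing E)) (a b : E) js :
  bracket_rec xs ((a, b) :: js) = bracket_rec xs ((b, a) :: js).
Proof.
apply: eq_bracket_rec => x y; rewrite /joined !inE !xpair_eqE.
by do 2!case: (_ \in js); rewrite ?orbT //= !orbF orbC ![_ && (_ == b)]andbC.
Qed.

Lemma bracket_rec_swap (E : finType) (xs : seq (crossing E)) p q js :
  bracket_rec xs [:: p, q & js] = bracket_rec xs [:: q, p & js].
Proof. by apply: eq_mem_bracket_rec => r; rewrite !inE orbCA. Qed.

(** * Moving caps along a twist region *)

Section Slide.

Variables (E : finType) (a b c : bool -> E).
Variables (xs : seq (crossing E)) (js : seq (E * E)).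

Let away : pred E := fun e => (e != b true) && (e != b false).

Hypotheses (b_inj : b true != b false) (a_away : forall i, away (a i)).
Hypotheses (c_away : forall i, away (c i)).
Hypotheses (xs_away : all (crossing_in away) xs) (js_away : all (join_in away) js).

Let move_b (d : bool -> E) (e : E) : E :=
  if e == b true then d true else if e == b false then d false else e.

Let move_b_away d e : away e -> move_b d e = e.
Proof. by rewrite /move_b => /andP[/negPf-> /negPf->]. Qed.

Let move_bb d i : move_b d (b i) = d i.
Proof. by rewrite /move_b; case: i; rewrite !eqxx // eq_sym (negPf b_inj). Qed.

Let b_or_away e : (exists i, e = b i) \/ away e.
Proof.
rewrite /away; case: eqP => [->|_]; first by left; exists true.
by case: eqP => [->|_]; [left; exists false|right].
Qed.

(** [a], [b], [c] stand for three successive levels of a twist region, and only the listed joins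
    touch [b]. In [js1] level [b] prolongs [a] up to its cap, in [js2] it prolongs [c] down to its
    cap, and in [js3] it is a circle between the two caps. *)
Let js1 := [:: (b true, b false), (c true, c false), (a true, b true),
               (a false, b false) & js].
Let js2 := [:: (a true, a false), (b true, b false), (b true, c true),
               (b false, c false) & js].
Let js3 := [:: (b true, b false), (c true, c false), (a true, a false) & js].

Let js_awayP p : p \in js -> away p.1 /\ away p.2.
Proof. by move=> p_js; apply/andP/(allP js_away). Qed.

Ltac join_tac := by rewrite !inE eqxx ?orbT.
Ltac join1 := solve [exact: connect0 | apply: connect_join; join_tac
                    | apply: connect_join_sym; join_tac].

(** In both diagrams the ends of [a] are capped and so are those of [c]; contracting [b] onto [a] in
    one direction and onto [c] in the other is an equivalence. *)
Lemma bracket_slide : bracket_rec xs js1 = bracket_rec xs js2.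
Proof.
rewrite -[xs in RHS]map_crossing_id.
rewrite -(@eq_map_crossing _ _ (move_b a) _ _ _ (move_b_away a) xs_away).
apply: (bracket_equiv (s := move_b c)); split=> [p|p|x|z].
- rewrite !inE => /predU1P[->|/predU1P[->|/predU1P[->|/predU1P[->|p_js]]]] /=;
    rewrite ?move_bb ?(move_b_away _ (a_away _)) ?(move_b_away _ (c_away _)).
  + join1.
  + by apply: (@connect_trans _ _ (b true)); last
      apply: (@connect_trans _ _ (b false)); join1.
  + join1.
  + join1.
  + have [Q1 Q2] := js_awayP p_js; rewrite !move_b_away //.
    by apply: connect_join; rewrite -surjective_pairing !inE p_js !orbT.
- rewrite !inE => /predU1P[->|/predU1P[->|/predU1P[->|/predU1P[->|p_js]]]] /=;
    rewrite ?move_bb ?(move_b_away _ (a_away _)) ?(move_b_away _ (c_away _)).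
  + by apply: (@connect_trans _ _ (b true)); last
      apply: (@connect_trans _ _ (b false)); join1.
  + join1.
  + join1.
  + join1.
  + have [Q1 Q2] := js_awayP p_js; rewrite !move_b_away //.
    by apply: connect_join; rewrite -surjective_pairing !inE p_js !orbT.
- have [[i ->]|xQ] := b_or_away x; last by rewrite !move_b_away.
  by rewrite move_bb move_b_away //; case: i; join1.
- have [[i ->]|xQ] := b_or_away z; last by rewrite !move_b_away.
  by rewrite move_bb move_b_away //; case: i; join1.
Qed.

Lemma bracket_circle : bracket_rec xs js3 = loop_value * bracket_rec xs js2.
Proof.
(* The circle through [b] is sent to the extra point [None], while the copy of [b] in [js2] is
   absorbed by [c]. *)
pose g e := if away e then Some e else None.
have g_away e : away e -> g e = Some e by rewrite /g => ->.
have gb i : g (b i) = None by rewrite /g /away; case: i; rewrite !eqxx ?andbF.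
rewrite -(bracket_rec_Some (a true)).
rewrite -(eq_map_crossing g_away xs_away).
apply: (bracket_equiv (s := fun z => if z is Some e then move_b c e else b true)).
split=> [p|p|x|z].
- rewrite !inE => /predU1P[->|/predU1P[->|/predU1P[->|p_js]]] /=;
    rewrite ?gb ?(g_away _ (a_away _)) ?(g_away _ (c_away _)).
  + join1.
  + by apply: (@connect_trans _ _ (Some (b true))); last
      apply: (@connect_trans _ _ (Some (b false))); join1.
  + join1.
  + have [Q1 Q2] := js_awayP p_js; rewrite !g_away //.
    apply: connect_join; rewrite !inE; do 4!(apply/orP; right).
    exact: (map_f (map_join Some) p_js).
- case/mapP=> q; rewrite !inE.
  case/predU1P=> [->|/predU1P[->|/predU1P[->|/predU1P[->|p_js]]]] -> /=;
    rewrite ?move_bb ?(move_b_away _ (a_away _)) ?(move_b_away _ (c_away _)).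
  + join1.
  + join1.
  + join1.
  + join1.
  + have [Q1 Q2] := js_awayP p_js; rewrite !move_b_away //.
    by apply: connect_join; rewrite -surjective_pairing !inE p_js !orbT.
- have [[i ->]|xQ] := b_or_away x; last by rewrite g_away // move_b_away.
  by rewrite gb; case: i; join1.
- case: z => [z|]; last by rewrite gb.
  have [[i ->]|xQ] := b_or_away z; last by rewrite move_b_away ?g_away.
  by rewrite move_bb g_away //; case: i; join1.
Qed.

End Slide.

(** * Twist regions *)

Definition parallel (E : Type) (v : nat -> bool -> E) (m n : nat) : seq (E * E) :=
  flatten [seq [:: (v k true, v k.+1 true); (v k false, v k.+1 false)]
          | k <- iota m n].

(* The edges strictly inside the twist region are attached to its upper end.  For
   [n = 0] this is a junk value, always met with the coefficient
   [cut_coef u 0 = 0]. *)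
Definition cut (E : Type) (v : nat -> bool -> E) (m n : nat) : seq (E * E) :=
  [:: (v m true, v m false), (v m.+1 true, v m.+1 false) &
      parallel v m.+1 n.-1].

Definition twist_crossing (E : Type) (pos : bool) (v : nat -> bool -> E) (k : nat) :=
  if pos then X (v k true) (v k false) (v k.+1 false) (v k.+1 true)
  else X (v k false) (v k.+1 false) (v k.+1 true) (v k true).

Definition twist_unit (pos : bool) : laurent := if pos then varA^-1 else varA.

(* A crossing is [u] times the kept state plus [u^-1] times the cut state, and a
   crossing stacked on the cut state multiplies it by [- u ^- 3]. *)
Definition cut_coef (u : laurent) (n : nat) : laurent :=
  ((- u ^- 3) ^+ n - u ^+ n) / loop_value.

Lemma varA_neq0 : varA != 0.
Proof. by rewrite invr_eq0 tofrac_eq0 polyX_eq0. Qed.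

Lemma twist_unit_neq0 pos : twist_unit pos != 0.
Proof. by case: pos; [rewrite /twist_unit invr_eq0|]; apply: varA_neq0. Qed.

Lemma loop_valueE pos :
  loop_value = - twist_unit pos ^+ 2 - twist_unit pos ^- 2.
Proof.
have loopV (F : fieldType) (x : F) : - x ^+ 2 - x ^- 2 = - x^-1 ^+ 2 - x^-1 ^- 2.
  by rewrite -exprVn invrK addrC exprVn.
by case: pos; [apply: loopV|].
Qed.

Lemma bracket_rec_twist (E : finType) pos (v : nat -> bool -> E) k xs js :
  bracket_rec (twist_crossing pos v k :: xs) js =
    twist_unit pos * bracket_rec xs (parallel v k 1 ++ js)
    + (twist_unit pos)^-1 *
      bracket_rec xs [:: (v k true, v k false), (v k.+1 true, v k.+1 false) & js].
Proof.
case: pos; rewrite /twist_unit /= ?invrK; [rewrite addrC|];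
  congr (_ * _ + _ * _).
- by rewrite bracket_rec_swap bracket_rec_flip.
- by rewrite bracket_rec_swap bracket_rec_flip bracket_rec_swap.
- by rewrite bracket_rec_swap bracket_rec_flip.
- by rewrite bracket_rec_flip bracket_rec_swap.
Qed.

Lemma varA_tofrac : varA^-1 = tofrac 'X.
Proof. exact: invrK. Qed.

Lemma tofrac_neq0 (P : {poly int}) : P.[1] != 0 -> tofrac P != 0 :> laurent.
Proof. by apply: contraNneq => /eqP; rewrite tofrac_eq0 => /eqP->; rewrite horner0. Qed.

Lemma loop_value_neq0 : loop_value != 0.
Proof.
(* With X the inverse of A, the loop value is -(X^4 + 1) / X^2; the numerator is nonzero because its
   value at 1 is. *)
have : tofrac ('X^4 + 1) != 0 :> laurent.
  by apply: tofrac_neq0; rewrite !hornerE expr1n.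
apply: contraNneq => loop0; rewrite tofracD tofracXn tofrac1 -varA_tofrac.
have factor (F : fieldType) (x : F) :
    x != 0 -> x^-1 ^+ 4 + 1 = - x^-1 ^+ 2 * (- x ^+ 2 - x ^- 2).
  by move=> ?; field.
by rewrite (factor _ _ varA_neq0) -/loop_value loop0 mulr0.
Qed.

Lemma loop_value_sqr_neq1 : loop_value ^+ 2 - 1 != 0.
Proof.
(* This is the numerator of d^2 - 1 over X^4, where d is the loop value. *)
have : tofrac ('X^8 + 'X^4 + 1) != 0 :> laurent.
  by apply: tofrac_neq0; rewrite !hornerE !expr1n.
apply: contraNneq => loop1; rewrite !tofracD !tofracXn tofrac1 -varA_tofrac.
have factor (F : fieldType) (x : F) : x != 0 ->
    x^-1 ^+ 8 + x^-1 ^+ 4 + 1 = x^-1 ^+ 4 * ((- x ^+ 2 - x ^- 2) ^+ 2 - 1).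
  by move=> ?; field.
by rewrite (factor _ _ varA_neq0) -/loop_value loop1 mulr0.
Qed.

(** The recursion of one added crossing: if it is kept, the other [n] must give a cut; if it is cut,
    they are either kept, or cut at the price of a free circle. *)
Lemma cut_coefS pos n (u := twist_unit pos) :
  cut_coef u n.+1 = u * cut_coef u n + u^-1 * (u ^+ n + loop_value * cut_coef u n).
Proof.
have step (F : fieldType) (x y z d : F) : x != 0 -> d != 0 -> d = - x ^+ 2 - x ^- 2 ->
    (- x ^- 3 * y - x * z) / d = x * ((y - z) / d) + x^-1 * (z + d * ((y - z) / d)).
  move=> x0 d0 dE; apply: (mulIf d0); rewrite divfK // [d * _]mulrC divfK //.
  rewrite mulrDl -mulrA divfK //.
  by rewrite dE; field.
rewrite /cut_coef !(exprS _ n).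
exact: step (twist_unit_neq0 pos) loop_value_neq0 (loop_valueE pos).
Qed.

Lemma cut_coef0 u : cut_coef u 0 = 0.
Proof. by rewrite /cut_coef !expr0 subrr mul0r. Qed.

Lemma parallelS (E : Type) (v : nat -> bool -> E) m n :
  parallel v m n.+1 =
    [:: (v m true, v m.+1 true), (v m false, v m.+1 false) & parallel v m.+1 n].
Proof. by []. Qed.

(** Induction on the number of crossings, smoothing the lowest one first. [Q] holds of all edges met
    by the rest of the diagram, hence of no edge strictly inside the region. *)
Lemma twist_bracket (E : finType) (Q : pred E) pos v m n xs js :
    (forall k i k' i', (m <= k <= m + n)%N -> (m <= k' <= m + n)%N ->
       v k i = v k' i' -> k = k' /\ i = i') ->
    (forall k i, (m < k < m + n)%N -> ~~ Q (v k i)) ->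
    all (crossing_in Q) xs -> all (join_in Q) js ->
  bracket_rec ([seq twist_crossing pos v k | k <- iota m n] ++ xs) js =
    twist_unit pos ^+ n * bracket_rec xs (parallel v m n ++ js)
    + cut_coef (twist_unit pos) n * bracket_rec xs (cut v m n ++ js).
Proof.
elim: n Q m js => [|n IHn] Q m js v_inj v_Q xsQ jsQ.
  by rewrite cut_coef0 mul0r addr0 expr0 mul1r.
set u := twist_unit pos.
(* The smoothing of the lowest crossing adds joins on these four edges to the rest of the
   diagram. *)
pose Q' e := Q e || (e \in [:: v m true; v m false; v m.+1 true; v m.+1 false]).
have sub e : Q e -> Q' e by rewrite /Q' => ->.
have v_inj' k i k' i' : (m < k <= m.+1 + n)%N -> (m < k' <= m.+1 + n)%N ->
    v k i = v k' i' -> k = k' /\ i = i'.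
  by move=> ? ?; apply: v_inj; lia.
have v_Q' k i : (m.+1 < k < m.+1 + n)%N -> ~~ Q' (v k i).
  move=> lt_k; rewrite negb_or v_Q /=; last by lia.
  by apply/negP; rewrite !inE => /or4P[] /eqP/v_inj[]; lia.
have xsQ' : all (crossing_in Q') xs.
  apply: sub_all xsQ => x /and4P[? ? ? ?].
  by rewrite /crossing_in !sub.
have jsQ' : all (join_in Q') js.
  by apply: sub_all jsQ => x /andP[? ?]; rewrite /join_in !sub.
have Q'0 i : Q' (v m i) by rewrite /Q' !inE; case: i; rewrite eqxx !orbT.
have Q'1 i : Q' (v m.+1 i) by rewrite /Q' !inE; case: i; rewrite eqxx !orbT.
rewrite [iota m n.+1]/= map_cons cat_cons bracket_rec_twist.
rewrite !(IHn Q' m.+1) //; last 2 first.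
- by rewrite /= jsQ' /join_in /= !(Q'0, Q'1).
- by rewrite /= jsQ' /join_in /= !(Q'0, Q'1).
have -> : bracket_rec xs (parallel v m.+1 n ++ parallel v m 1 ++ js)
        = bracket_rec xs (parallel v m n.+1 ++ js).
  by apply: eq_mem_bracket_rec => p; rewrite parallelS !(mem_cat, inE) /=;
    do ![case: (_ \in _)]; rewrite ?orbT ?orbF.
set js2 := [:: _, _ & js].
have -> : bracket_rec xs (parallel v m.+1 n ++ js2)
        = bracket_rec xs (cut v m n.+1 ++ js).
  by apply: eq_mem_bracket_rec => p; rewrite !(mem_cat, inE) /=;
    do ![case: (_ \in _)]; rewrite ?orbT ?orbF.
rewrite exprS cut_coefS -/u.
(* For a single crossing the remaining region is empty; its cut states are junk, but have
   coefficient 0. *)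
case: n => [|n] in IHn v_inj v_Q v_inj' v_Q' js2 *.
  by rewrite cut_coef0 !(mul0r, mulr0, addr0, add0r) !mulrA.
have b_inj : v m.+1 true != v m.+1 false by apply/eqP => /v_inj[]; lia.
pose away e := (e != v m.+1 true) && (e != v m.+1 false).
have Q_away e : Q e -> away e.
  by move=> Qe; apply/andP; split; apply: contraTneq Qe => ->; apply: v_Q; lia.
have v_away k i : (m <= k <= m + n.+2)%N -> k != m.+1 -> away (v k i).
  by move=> k_le k_neq; apply/andP; split; apply/eqP => /v_inj[]; lia.
have xs_away : all (crossing_in away) xs.
  by apply: sub_all xsQ => x /and4P[? ? ? ?]; rewrite /crossing_in !Q_away.
set R := parallel v m.+2 n ++ js.
have R_away : all (join_in away) R.
  rewrite all_cat; apply/andP; split; last first.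
    by apply: sub_all jsQ => x /andP[? ?]; rewrite /join_in !Q_away.
  apply/allP => p /flatten_mapP[k]; rewrite mem_iota !inE => k_lt.
  by case/orP=> /eqP->; rewrite /join_in /= !v_away //; lia.
have a_away i : away (v m i) by apply: v_away; lia.
have c_away i : away (v m.+2 i) by apply: v_away; lia.
(* Lowest crossing kept, the rest cut: the cut slides down one level. *)
have -> : bracket_rec xs (cut v m.+1 n.+1 ++ parallel v m 1 ++ js)
        = bracket_rec xs (cut v m n.+2 ++ js).
  rewrite -[RHS](bracket_slide b_inj a_away c_away xs_away R_away).
  apply/eq_mem_bracket_rec/perm_mem; rewrite /= !perm_cons.
  by rewrite (perm_catCA _ [:: _; _]).
(* Both cut: level [m.+1] closes up into a circle. *)
have -> : bracket_rec xs (cut v m.+1 n.+1 ++ js2)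
        = loop_value * bracket_rec xs (cut v m n.+2 ++ js).
  rewrite -[in RHS](bracket_circle b_inj a_away c_away xs_away R_away).
  apply: eq_mem_bracket_rec => p; rewrite /js2 /cut !(mem_cat, inE) -!orbA.
  by case: (p == (v m.+1 true, _)) => //=; congr (_ || _); rewrite orbCA.
have expand (F : comPzRingType) (x y z w t d P C : F) :
    x * (z * P + w * C) + y * (z * C + w * (d * C))
    = x * z * P + (x * w + y * (z + d * w)) * C by ring.
exact: expand.
Qed.

(** * The bracket of [K L] *)

Section Edges.

Variable L : labels.
Implicit Types (j : 'I_6) (e : edge L).

Definition level e : nat := (tagged e).1.
Definition on_left e : bool := (tagged e).2.

Lemma level_mk j k b : (k <= leg_size L j)%N -> level (mk_edge L j k b) = k.
Proof. exact: inordK. Qed.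

Lemma level_le e : (level e <= leg_size L (tag e))%N.
Proof. by rewrite -ltnS ltn_ord. Qed.

Lemma mk_edgeK e : mk_edge L (tag e) (level e) (on_left e) = e.
Proof. by case: e => j [k b]; rewrite /mk_edge /level /= inord_val. Qed.

Lemma mk_edge_inj j k b j' k' b' :
    (k <= leg_size L j)%N -> (k' <= leg_size L j')%N ->
  mk_edge L j k b = mk_edge L j' k' b' -> [/\ j = j', k = k' & b = b'].
Proof.
move=> le_k le_k' eq_e; split; first exact: (congr1 tag eq_e).
  by rewrite -(level_mk b le_k) -(level_mk b' le_k') eq_e.
exact: (congr1 on_left eq_e).
Qed.

End Edges.

Definition leg_state (L : labels) (p : 'I_6 * bool) : seq (edge L * edge L) :=
  (if p.2 then cut else parallel) _ (mk_edge L p.1) 0 (leg_size L p.1).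

Definition leg_unit (L : labels) (j : 'I_6) : laurent :=
  twist_unit (0 < leg_label L j).

Definition leg_kept (L : labels) (j : 'I_6) : laurent :=
  leg_unit L j ^+ leg_size L j.

Definition leg_cut (L : labels) (j : 'I_6) : laurent :=
  cut_coef (leg_unit L j) (leg_size L j).

(** State sum over the legs still to be expanded; [st] records the choices already made. The general
    ring lets the final evaluation be a polynomial identity in indeterminate coefficients. *)
Fixpoint expand (R : pzRingType) (x y : 'I_6 -> R)
    (leaf : seq ('I_6 * bool) -> R) (legs : seq 'I_6) (st : seq ('I_6 * bool)) : R :=
  if legs is j :: legs' then
    x j * expand x y leaf legs' ((j, false) :: st)
    + y j * expand x y leaf legs' ((j, true) :: st)
  else leaf st.

Definition states (L : labels) (st : seq ('I_6 * bool)) : seq (edge L * edge L) :=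
  flatten [seq leg_state L p | p <- st].

Definition K_state_value (L : labels) (st : seq ('I_6 * bool)) : laurent :=
  loop_value ^+ (loops (states L st ++ joins (K L))).-1.

Lemma bracket_rec_legs L legs st :
    uniq legs -> all (fun p => p.1 \notin legs) st ->
  bracket_rec (flatten [seq leg_crossings L j | j <- legs])
              (states L st ++ joins (K L))
  = expand (leg_kept L) (leg_cut L) (K_state_value L) legs st.
Proof.
elim: legs st => [|j legs IHlegs] st //= /andP[j_legs legs_uniq] st_legs.
rewrite -!IHlegs //=; last 2 first.
- by rewrite j_legs; apply: sub_all st_legs => p; rewrite inE negb_or => /andP[].
- by rewrite j_legs; apply: sub_all st_legs => p; rewrite inE negb_or => /andP[].
(* Everything except the edges strictly inside leg [j]: the other legs and all joins meet leg [j]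
   only at its ends. *)
set Q : pred (edge L) := fun e =>
  (tag e != j) || (level e == 0) || (level e == leg_size L j).
have crossQ : all (crossing_in Q) (flatten [seq leg_crossings L i | i <- legs]).
  elim: (legs) j_legs => //= i ls IHls; rewrite inE negb_or all_cat => /andP[ij /IHls->].
  have tagQ k b : Q (mk_edge L i k b) by rewrite /Q /= eq_sym ij.
  rewrite andbT /leg_crossings all_map; apply/allP => k _ /=.
  by rewrite /leg_crossing; case: ifP => _; rewrite /crossing_in /= !tagQ.
have joinQ : all (join_in Q) (states L st ++ joins (K L)).
  rewrite all_cat; apply/andP; split; apply/(@allP _ (join_in Q)).
    move=> x /flatten_mapP[[i c] /(allP st_legs)]; rewrite inE negb_or => /andP[/= ij _].
    have tagQ k' b : Q (mk_edge L i k' b) by rewrite /Q /= ij.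
    have par m n : x \in parallel (mk_edge L i) m n -> join_in Q x.
      by case/flatten_mapP=> k _; rewrite !inE => /orP[]/eqP->; rewrite /join_in /= !tagQ.
    case: c; last exact: par.
    rewrite /leg_state /cut !inE => /or3P[/eqP->|/eqP->|/par //];
      by rewrite /join_in /= !tagQ.
  have endQ i b : Q (mk_edge L i 0 b) && Q (mk_edge L i (leg_size L i) b).
    rewrite /Q !level_mk //= orbT /=.
    by case: eqP => //= ->; rewrite eqxx orbT.
  move=> x /flatten_mapP[i _]; rewrite !inE => /orP[]/eqP->; rewrite /join_in /=;
    by rewrite ?(andP (endQ _ _)).1 ?(andP (endQ _ _)).2.
rewrite /leg_crossings (@twist_bracket _ Q (0 < leg_label L j)) //.
- by rewrite /states /= -!catA.
- move=> k i k' i' k_le k'_le /mk_edge_inj[] //.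
- move=> k i k_lt; rewrite /Q /= eqxx level_mk; lia.
Qed.

(* The node [(j, top, left)] stands for an extreme edge of leg [j]: the one at
   [C] if [top], at the trivalent vertex otherwise. *)
Definition node := ('I_6 * bool * bool)%type.

Definition model_state (p : 'I_6 * bool) : seq (node * node) :=
  let: (j, c) := p in
  if c then [:: ((j, false, true), (j, false, false));
                ((j, true, true), (j, true, false))]
  else [:: ((j, false, true), (j, true, true));
           ((j, false, false), (j, true, false))].

Definition model_joins (j : 'I_6) : seq (node * node) :=
  [:: ((j, true, ~~ odd j), (j + 1, true, odd (j + 1)%R));
      ((j, false, ~~ odd j), (j + 2%:R, false, odd (j + 2%:R)%R))].

Definition model (legs : seq 'I_6) (st : seq ('I_6 * bool)) : seq (node * node) :=
  flatten [seq model_state p | p <- st] ++ flatten [seq model_joins j | j <- legs].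

Lemma connect_parallel (E : finType) (v : nat -> bool -> E) js m n k b :
    {subset parallel v m n <= js} -> (m <= k <= m + n)%N ->
  connect (joined js) (v m b) (v k b).
Proof.
move=> sub; elim: k => [|k IHk] k_le; first by have -> : m = 0%N by lia.
have [->|m_neq] := eqVneq m k.+1; first exact: connect0.
apply: connect_trans (IHk _) _; first by lia.
apply/connect_join/sub/flatten_mapP; exists k; first by rewrite mem_iota; lia.
by case: b {IHk}; rewrite !inE eqxx ?orbT.
Qed.

Section Model.

Variables (L : labels) (st : seq ('I_6 * bool)).
Hypothesis st_full : forall j, j \in unzip1 st.
Hypothesis st_cut : forall j, (j, true) \in st -> (0 < leg_size L j)%N.

Let js := states L st ++ joins (K L).
Let js' := model (enum 'I_6) st.

Let to_node (e : edge L) : node := (tag e, (0 < level e)%N, on_left e).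

Let of_node (z : node) : edge L :=
  mk_edge L z.1.1 (if z.1.2 then leg_size L z.1.1 else 0%N) z.2.

Let to_node_mk j k b :
  (k <= leg_size L j)%N -> to_node (mk_edge L j k b) = (j, (0 < k)%N, b).
Proof. by move=> k_le; rewrite /to_node level_mk. Qed.

Let model_stP j c p : (j, c) \in st -> p \in model_state (j, c) -> p \in js'.
Proof.
by move=> jc pP; rewrite mem_cat; apply/orP; left; apply/flatten_mapP; exists (j, c).
Qed.

Let statesP j c p : (j, c) \in st -> p \in leg_state L (j, c) -> p \in js.
Proof.
by move=> jc pP; rewrite mem_cat; apply/orP; left; apply/flatten_mapP; exists (j, c).
Qed.

Let stP j : exists2 c, (j, c) \in st & (c -> 0 < leg_size L j)%N.
Proof.
have /mapP[[i c] ic /= ->] := st_full j; exists c => //.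
by case: c ic => // /st_cut.
Qed.

(* A leg without crossings is not cut, so its only edges, of level 0, may be
   moved to its top. *)
Let node_top j k b : (0 < leg_size L j -> 0 < k)%N ->
  connect (joined js') (j, (0 < k)%N, b) (j, true, b).
Proof.
case: k => [|k] pos; last exact: connect0.
have [c jc c_pos] := stP j; case: c jc c_pos => [_ /(_ isT)/pos //|jc _].
by apply/connect_join/(model_stP jc); case: b; rewrite !inE eqxx ?orbT.
Qed.

(** Valid in both states, since a cut separates only level 0 from level 1. *)
Let edge_top j k b : (0 < k <= leg_size L j)%N ->
  connect (joined js) (mk_edge L j k b) (mk_edge L j (leg_size L j) b).
Proof.
move=> k_le; have [c jc _] := stP j.
have sub : {subset parallel (mk_edge L j) 1 (leg_size L j).-1 <= js}.
  move=> p pP; apply: (statesP jc); case: c {jc}; rewrite /leg_state /=.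
    by rewrite !inE pP !orbT.
  by case: leg_size k_le pP => [|n] _ // pP; rewrite parallelS !inE pP !orbT.
apply: (@connect_trans _ _ (mk_edge L j 1 b)); last by apply: connect_parallel sub _; lia.
by rewrite connect_joined_sym; apply: connect_parallel sub _; lia.
Qed.

(** Each leg is contracted to its four extreme edges, which leaves a diagram independent of the
    labels. A cut leg needs a crossing, as otherwise its top and bottom edges coincide. *)
Lemma states_model : loops js = loops js'.
Proof.
apply: (@loops_equiv _ _ to_node of_node); split=> [p|p|e|z].
- rewrite mem_cat => /orP[/flatten_mapP[[j c] jc]|/flatten_mapP[j _]].
    have par m n : (m + n <= leg_size L j)%N -> (c -> 0 < m)%N ->
        p \in parallel (mk_edge L j) m n ->
      connect (joined js') (to_node p.1) (to_node p.2).
      move=> mn_le m_pos /flatten_mapP[k]; rewrite mem_iota => k_le.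
      have [k1 k2] : (k <= leg_size L j)%N /\ (k.+1 <= leg_size L j)%N by lia.
      case: k => [|k] in k_le k1 k2 *; last first.
        by rewrite !inE => /orP[]/eqP-> /=; rewrite !to_node_mk.
      have cF : c = false by case: c m_pos {jc} => // /(_ isT); lia.
      rewrite cF in jc.
      rewrite !inE => /orP[]/eqP-> /=; rewrite !to_node_mk //;
        by apply/connect_join/(model_stP jc); rewrite !inE eqxx ?orbT.
    case: c => [|] in jc par *; last by apply: par; rewrite ?add0n.
    have size_pos := st_cut jc.
    rewrite /leg_state /cut !inE => /or3P[/eqP->|/eqP->|]; last by apply: par => //=; lia.
      rewrite /= !to_node_mk //.
      by apply/connect_join/(model_stP jc); rewrite !inE eqxx ?orbT.
    rewrite /= !to_node_mk //.
    by apply/connect_join/(model_stP jc); rewrite !inE eqxx ?orbT.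
  have joinP x y : (x, y) \in model_joins j -> connect (joined js') x y.
    move=> xy; apply: connect_join; rewrite mem_cat; apply/orP; right.
    by apply/flatten_mapP; exists j; rewrite ?mem_enum.
  rewrite !inE => /orP[]/eqP->; rewrite /= !to_node_mk //.
    apply: connect_trans (node_top _ _) _ => //; rewrite connect_joined_sym.
    apply: connect_trans (node_top _ _) _ => //; rewrite connect_joined_sym.
    by apply: joinP; rewrite mem_head.
  by apply: joinP; rewrite in_cons mem_head orbT.
- rewrite mem_cat => /orP[/flatten_mapP[[j c] jc]|/flatten_mapP[j _]].
    case: c jc => jc; rewrite !inE => /orP[]/eqP-> /=.
    + by apply/connect_join/(statesP jc); rewrite !inE eqxx.
    + have size_pos := st_cut jc.
      apply: (@connect_trans _ _ (mk_edge L j 1 true)); last first.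
        apply: (@connect_trans _ _ (mk_edge L j 1 false)); last exact: edge_top.
        by apply/connect_join/(statesP jc); rewrite !inE eqxx orbT.
      by rewrite connect_joined_sym edge_top.
    + apply: (@connect_parallel _ _ _ 0 (leg_size L j)); last by rewrite leq0n /=.
      by move=> q; exact: statesP jc.
    + apply: (@connect_parallel _ _ _ 0 (leg_size L j)); last by rewrite leq0n /=.
      by move=> q; exact: statesP jc.
  rewrite !inE => /orP[]/eqP-> /=; apply: connect_join; rewrite mem_cat;
    apply/orP; right; apply/flatten_mapP; exists j; rewrite ?mem_enum //;
    by rewrite !inE eqxx ?orbT.
- rewrite -{1}(mk_edgeK e) /of_node /=; have := level_le e.
  case: (level e) => [|k] k_le; first exact: connect0.
  exact: edge_top.
- case: z => [[j t] b]; rewrite /of_node /= to_node_mk; last by case: t.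
  case: t; last exact: connect0.
  by rewrite connect_joined_sym node_top.
Qed.

End Model.

(** * Counting closed curves by computation *)

Lemma loops_nil (E : finType) : loops ([::] : seq (E * E)) = #|E|.
Proof.
have noedge (x y : E) : connect (joined [::]) x y -> x = y.
  by case/connectP=> [[|z p]] /=.
apply: eq_card => x; rewrite !inE andbT /roots /=.
by apply/eqP; rewrite -(noedge _ _ (connect_root _ x)).
Qed.

Definition merge_blocks (T : eqType) (p : T * T) (P : seq (seq T)) : seq (seq T) :=
  let meets (B : seq T) := (p.1 \in B) || (p.2 \in B) in
  flatten (filter meets P) :: filter (predC meets) P.

Definition blocks (T : eqType) (vs : seq T) (js : seq (T * T)) : seq (seq T) :=
  foldr (@merge_blocks T) [seq [:: v] | v <- vs] js.

(** This half of the correctness of [blocks] holds in general; that joins stay within blocks is left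
    to the certificate below. *)
Lemma blocks_connected (T : finType) (vs : seq T) js B x y :
  B \in blocks vs js -> x \in B -> y \in B -> connect (joined js) x y.
Proof.
elim: js B x y => [|p js IHjs] B x y.
  by case/mapP=> v _ ->; rewrite !inE => /eqP-> /eqP->.
have sub z t : connect (joined js) z t -> connect (joined (p :: js)) z t.
  apply: (connect_image (g := id)) => r r_js.
  by apply: connect_join; rewrite inE -surjective_pairing r_js orbT.
have pp : connect (joined (p :: js)) p.1 p.2.
  by apply: connect_join; rewrite -surjective_pairing mem_head.
rewrite /= inE => /predU1P[->|]; last first.
  by rewrite mem_filter => /andP[_ BP] xB yB; apply/sub/(IHjs B).
have meet z : z \in flatten [seq B <- blocks vs js | (p.1 \in B) || (p.2 \in B)] ->
    connect (joined (p :: js)) z p.1.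
  case/flattenP=> C; rewrite mem_filter => /andP[/orP[pC|pC] CP] zC.
    exact/sub/(IHjs C).
  apply: (@connect_trans _ _ p.2); first exact/sub/(IHjs C).
  by rewrite connect_joined_sym.
move=> /meet xp /meet yp; apply: connect_trans xp _.
by rewrite connect_joined_sym.
Qed.

Definition block_index (T : eqType) (P : seq (seq T)) (x : T) : nat :=
  find (fun B => x \in B) P.

(* A certificate checked by computation for each of the 64 states. *)
Definition blocks_ok (T : eqType) (x0 : T) (vs : seq T) (js : seq (T * T)) : bool :=
  let P := blocks vs js in
  [&& all (fun x => block_index P x < size P)%N vs,
      all (fun p => block_index P p.1 == block_index P p.2) js
    & all (fun i => let B := nth [::] P i in
                    (head x0 B \in B) && (block_index P (head x0 B) == i))
          (iota 0 (size P))].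

(** The block index, with the head of a block as section, contracts the diagram to one isolated
    point per block. *)
Lemma loops_blocks (T : finType) (x0 : T) (vs : seq T) js :
  (forall x, x \in vs) -> blocks_ok x0 vs js -> loops js = size (blocks vs js).
Proof.
move=> vsP /and3P[]; set P := blocks vs js.
move=> /allP idx_lt /allP idx_eq /allP headP.
have headP' i : (i < size P)%N -> head x0 (nth [::] P i) \in nth [::] P i /\
    block_index P (head x0 (nth [::] P i)) = i.
  by move=> i_lt; have := headP i; rewrite mem_iota => /(_ i_lt) /andP[-> /eqP->].
pose g x : 'I_(size P) := Ordinal (idx_lt x (vsP x)).
pose s (i : 'I_(size P)) := head x0 (nth [::] P i).
rewrite (@loops_equiv _ _ g s js [::]) ?loops_nil ?card_ord //.
split=> [p pP|//|x|i].
- by have -> : g p.1 = g p.2 by apply/val_inj/eqP/idx_eq.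
- have [head_in _] := headP' _ (idx_lt x (vsP x)).
  apply: (blocks_connected (vs := vs) (B := nth [::] P (block_index P x))) => //.
    by rewrite mem_nth // idx_lt.
  by apply: (nth_find [::] (a := fun B => x \in B)); rewrite has_find idx_lt.
- by have -> : g (s i) = i by apply/val_inj; have [] := headP' i (ltn_ord i).
Qed.

Fixpoint all_states (legs : seq 'I_6) (st : seq ('I_6 * bool)) :
    seq (seq ('I_6 * bool)) :=
  if legs is j :: legs' then
    all_states legs' ((j, false) :: st) ++ all_states legs' ((j, true) :: st)
  else [:: st].

(** A state that cuts a leg with zero cut coefficient does not contribute. This discards the cuts of
    legs without crossings, where [states_model] does not apply. *)
Lemma eq_expand (R : pzRingType) (x y : 'I_6 -> R) leaf leaf' legs st :
    (forall st', st' \in all_states legs st ->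
       (forall j, (j, true) \in st' -> y j != 0 \/ (j, true) \in st) ->
       leaf st' = leaf' st') ->
  expand x y leaf legs st = expand x y leaf' legs st.
Proof.
elim: legs st => [|j legs IHlegs] st eq_leaf /=.
  by apply: eq_leaf => [|j ->]; [exact: mem_head|right].
congr (_ * _ + _).
  apply: IHlegs => st' st'P y_neq0; apply: eq_leaf => [|i /y_neq0].
    by rewrite mem_cat st'P.
  by rewrite inE xpair_eqE andbF.
have [yj0|yj_neq0] := eqVneq (y j) 0; first by rewrite yj0 !mul0r.
congr (_ * _); apply: IHlegs => st' st'P y_neq0; apply: eq_leaf.
  by rewrite mem_cat st'P orbT.
move=> i /y_neq0[|]; first by left.
by rewrite inE => /predU1P[[->]|]; [left|right].
Qed.

Definition legs6 : seq 'I_6 :=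
  [:: @Ordinal 6 0 isT; @Ordinal 6 1 isT; @Ordinal 6 2 isT;
      @Ordinal 6 3 isT; @Ordinal 6 4 isT; @Ordinal 6 5 isT].

Lemma enum_legs6 : enum 'I_6 = legs6.
Proof. by apply: (inj_map val_inj); rewrite val_enum_ord. Qed.

Definition nodes : seq node :=
  [seq (z, b) | z <- [seq (j, t) | j <- legs6, t <- [:: false; true]],
                b <- [:: false; true]].

Lemma mem_nodes z : z \in nodes.
Proof.
case: z => [[j t] b]; apply: allpairs_f; last by case: b.
by apply: allpairs_f; [rewrite -enum_legs6 mem_enum | case: t].
Qed.

Definition model_exponent (st : seq ('I_6 * bool)) : nat :=
  (size (blocks nodes (model legs6 st))).-1.

Lemma all_states_ok :
  all (fun st => blocks_ok (ord0, false, false) nodes (model legs6 st)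
              && all [in unzip1 st] legs6) (all_states legs6 [::]).
Proof. by vm_compute. Qed.

Lemma bracket_K L :
  bracket (K L) = expand (leg_kept L) (leg_cut L)
    (fun st => loop_value ^+ model_exponent st) legs6 [::].
Proof.
rewrite /bracket -[joins _]/(states L [::] ++ joins (K L)).
rewrite [crossings _]/= bracket_rec_legs ?enum_uniq // enum_legs6.
apply: eq_expand => st /(allP all_states_ok)/andP[ok /allP full] cut_neq0.
rewrite /K_state_value states_model ?enum_legs6.
- by rewrite (loops_blocks mem_nodes ok).
- by move=> j; apply: full; rewrite -enum_legs6 mem_enum.
move=> j /cut_neq0[|//]; rewrite /leg_cut.
by case: leg_size; rewrite ?cut_coef0 ?eqxx.
Qed.

(** * Closed form of the bracket *)

Definition all_kept (R : pzRingType) (u v w : R * R) : R := u.1 * v.1 * w.1.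

Definition one_cut (R : pzRingType) (u v w : R * R) : R := u.2 * v.1 * w.1.

(** Cutting two legs already gives the matching with three caps; cutting the third as well splits
    off a circle at the vertex, whence the factor [d]. *)
Definition many_cut (R : pzRingType) (d : R) (u v w : R * R) : R :=
  u.1 * v.2 * w.2 + u.2 * v.1 * w.2 + u.2 * v.2 * w.1 + d * (u.2 * v.2 * w.2).

Definition sum_one_cut (R : pzRingType) (u v w : R * R) : R :=
  one_cut u v w + one_cut v u w + one_cut w u v.

(* [p q r] are on the legs of [T] and [a b c] on those of [T'], as pairs (kept,
   cut).  The matching obtained by cutting only the leg [A_i] is also the one
   obtained by cutting only the opposite leg [B_(i + 1)]: hence the last sum. *)
Definition closed_form (R : pzRingType) (d : R) (p q r a b c : R * R) : R :=
  d ^+ 2 * (many_cut d p q r * all_kept a b c + all_kept p q r * many_cut d a b c)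
  + all_kept p q r * all_kept a b c + many_cut d p q r * many_cut d a b c
  + d * (all_kept p q r + many_cut d p q r) * sum_one_cut a b c
  + d * (all_kept a b c + many_cut d a b c) * sum_one_cut p q r
  + sum_one_cut p q r * sum_one_cut a b c
  + (d ^+ 2 - 1) * (one_cut p q r * one_cut b a c + one_cut q p r * one_cut c a b
                    + one_cut r p q * one_cut a b c).

Lemma expand_closed_form (R : comPzRingType) (x y : 'I_6 -> R) (d : R)
    (z := fun j : 'I_6 => (x j, y j)) :
  expand x y (fun st => d ^+ model_exponent st) legs6 [::]
  = closed_form d (z (@Ordinal 6 0 isT)) (z (@Ordinal 6 2 isT))
      (z (@Ordinal 6 4 isT)) (z (@Ordinal 6 1 isT)) (z (@Ordinal 6 3 isT))
      (z (@Ordinal 6 5 isT)).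
Proof.
rewrite /z /legs6 /=.
(* Each exponent of the 64 states is computed to a numeral, so that [ring] can compare both
   sides. *)
repeat match goal with |- context [model_exponent ?st] =>
  let n := eval vm_compute in (model_exponent st) in
  rewrite (_ : model_exponent st = n); last by vm_compute
end.
rewrite /closed_form /sum_one_cut /one_cut /many_cut /all_kept /=; ring.
Qed.

Definition twist_coefs (n : int) : laurent * laurent :=
  (twist_unit (0 < n) ^+ `|n|, cut_coef (twist_unit (0 < n)) `|n|).

Lemma bracket_K_closed_form p q r a b c :
  bracket (K ((p, q, r), (a, b, c))) =
    closed_form loop_value (twist_coefs p) (twist_coefs q) (twist_coefs r)
      (twist_coefs a) (twist_coefs b) (twist_coefs c).
Proof. by rewrite bracket_K expand_closed_form. Qed.

(** -A^4 is not a root of unity: its inverse is the polynomial -X^4, whose positive powers vanish at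
    0, unlike 1. *)
Lemma exprz_varA_inj : injective (fun n : int => (- varA ^+ 4) ^ n).
Proof.
set x := - varA ^+ 4.
have x_neq0 : x != 0 by rewrite oppr_eq0 expf_neq0 // varA_neq0.
have x_exp k : x ^+ k = 1 -> k = 0%N.
  move/(congr1 GRing.inv); rewrite invr1 -exprVn invrN -exprVn varA_tofrac.
  rewrite -tofracXn -tofracN -tofracXn -tofrac1 => /eqP; rewrite tofrac_eq => /eqP.
  move/(congr1 (horner^~ 0)); rewrite !hornerE; case: k => // k.
  by rewrite exprS expr0n /= oppr0 mul0r => /eqP; rewrite eq_sym oner_eq0.
move=> m n /= eq_mn; apply/eqP; rewrite -subr_eq0; apply/eqP.
have : x ^ (m - n) = 1 by rewrite expfzDr // eq_mn -expfzDr // subrr.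
case: (m - n) => [k /x_exp-> //|k].
rewrite NegzE -exprnN -exprVn => /(congr1 GRing.inv).
by rewrite exprVn invrK invr1 => /x_exp.
Qed.

Lemma twist_coefs_neq0 n : (twist_coefs n).1 != 0.
Proof. by rewrite expf_neq0 ?twist_unit_neq0. Qed.

(** The quotient of (-u^-3)^|n| by u^|n| is (-u^-4)^|n|. Since u is A^-1 or A according to the sign
    of [n], this is one formula for all labels, and the ratio of the two coefficients determines the
    label. *)
Lemma twist_coefs_ratio n :
  loop_value * ((twist_coefs n).2 / (twist_coefs n).1) + 1 = (- varA ^+ 4) ^ n.
Proof.
have ratio (F : fieldType) (d x : F) k : d != 0 -> x != 0 ->
    d * (((- x ^- 3) ^+ k - x ^+ k) / d / x ^+ k) + 1 = (- x^-1 ^+ 4) ^+ k.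
  move=> d0 x0; have xk0 : x ^+ k != 0 by rewrite expf_neq0.
  have -> : - x^-1 ^+ 4 = - x ^- 3 / x by rewrite mulNr -invfM -exprSr exprVn.
  by rewrite expr_div_n [_ / d / _]mulrAC mulrC divfK // mulrBl divff // subrK.
rewrite /twist_coefs /cut_coef (ratio _ _ _ _ loop_value_neq0 (twist_unit_neq0 _)).
rewrite /twist_unit.
have absE (F : fieldType) (x : F) :
    (- (if 0 < n then x^-1 else x)^-1 ^+ 4) ^+ `|n| = (- x ^+ 4) ^ n.
  case: n  => m; first by case: m => [|m]; rewrite ?expr0z //= invrK.
  by rewrite NegzE -exprnN -[RHS]exprVn invrN exprVn.
exact: absE.
Qed.

Lemma one_cut_inj p q r :
  one_cut (twist_coefs p) (twist_coefs q) (twist_coefs r)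
  = one_cut (twist_coefs q) (twist_coefs p) (twist_coefs r) -> p = q.
Proof.
move=> /(mulIf (twist_coefs_neq0 r)) eq_pq; apply: exprz_varA_inj.
rewrite /= -!twist_coefs_ratio; congr (_ * _ + _); apply/eqP.
by rewrite eqr_div ?twist_coefs_neq0 // eq_pq.
Qed.

(** * Symmetries and transpositions of the closed form *)

Lemma closed_form_swap (R : comPzRingType) (d : R) (p q r a b c : R * R) :
  closed_form d p q r a b c - closed_form d p q r b a c
  = (d ^+ 2 - 1) * ((one_cut p r q - one_cut r p q) * (one_cut b a c - one_cut a b c)).
Proof. rewrite /closed_form /sum_one_cut /many_cut /all_kept /one_cut; ring. Qed.

Lemma closed_form_rot (R : comPzRingType) (d : R) (p q r a b c : R * R) :
  closed_form d q r p b c a = closed_form d p q r a b c.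
Proof. rewrite /closed_form /sum_one_cut /many_cut /all_kept /one_cut; ring. Qed.

Lemma closed_form_refl (R : comPzRingType) (d : R) (p q r a b c : R * R) :
  closed_form d p r q c b a = closed_form d p q r a b c.
Proof. rewrite /closed_form /sum_one_cut /many_cut /all_kept /one_cut; ring. Qed.

(** Invariance is read off the closed form, without using isotopies. *)
Lemma bracket_K_D3 L L' : D3_symmetric L L' -> bracket (K L) = bracket (K L').
Proof.
elim=> {L L'} [L L' []|//|L L' _ ->|L1 L2 L3 _ -> _ ->] // p q r a b c;
  rewrite !bracket_K_closed_form.
- by rewrite -closed_form_rot.
- by rewrite closed_form_rot.
- by rewrite closed_form_refl.
Qed.

(** In the last sum of [closed_form], [b] is paired with [p] and [a] with [r]; hence the condition
    [p = r], and not [p = q]. *)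
Lemma bracket_K_swap p q r a b c :
  bracket (K ((p, q, r), (a, b, c))) = bracket (K ((p, q, r), (b, a, c))) ->
  p = r \/ a = b.
Proof.
rewrite !bracket_K_closed_form => /eqP; rewrite -subr_eq0 closed_form_swap.
rewrite !mulf_eq0 (negPf loop_value_sqr_neq1) orFb !subr_eq0 => /orP[]/eqP.
  by move=> eq_pr; left; exact: one_cut_inj eq_pr.
by move=> eq_ab; right; apply/esym; exact: one_cut_inj eq_ab.
Qed.

(** * The writhe of [K L] *)

(** Directions are flattened to one bit per strand, so that crossings and joins are treated
    alike. *)
Definition orient (E : Type) (P : seq (E * E)) (bs : seq bool) : seq (E * E) :=
  [seq directed y.2 y.1.1 y.1.2 | y <- zip P bs].

Definition crossing_strands (E : Type) (xs : seq (crossing E)) : seq (E * E) :=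
  flatten [seq [:: (xi x, xk x); (xj x, xl x)] | x <- xs].

Definition strands (E : Type) (D : diagram E) : seq (E * E) :=
  crossing_strands (crossings D) ++ joins D.

Definition crossing_bits (os : seq (bool * bool)) : seq bool :=
  flatten [seq [:: y.1; y.2] | y <- os].

Definition bits (E : Type) (D : diagram E) (o : directions D) : seq bool :=
  crossing_bits o.1 ++ o.2.

Lemma orient_cat (E : Type) (P Q : seq (E * E)) bs cs :
  size P = size bs -> orient (P ++ Q) (bs ++ cs) = orient P bs ++ orient Q cs.
Proof. by move=> eq_size; rewrite /orient zip_cat // map_cat. Qed.

Lemma size_orient (E : Type) (P : seq (E * E)) bs :
  size P = size bs -> size (orient P bs) = size P.
Proof. by move=> eq_size; rewrite size_map size1_zip // eq_size. Qed.

Lemma size_crossing_strands (E : Type) (xs : seq (crossing E)) :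
  size (crossing_strands xs) = (size xs).*2.
Proof. by elim: xs => //= x xs IHxs; rewrite IHxs. Qed.

Lemma size_crossing_bits os : size (crossing_bits os) = (size os).*2.
Proof. by elim: os => //= x os IHos; rewrite IHos. Qed.

Lemma size_strands (E : Type) (D : diagram E) (o : directions D) :
  size (strands D) = size (bits o).
Proof.
by rewrite !size_cat size_crossing_strands size_crossing_bits !size_tuple.
Qed.

Lemma directed_strandsE (E : Type) (D : diagram E) (o : directions D) :
  directed_strands o = orient (strands D) (bits o).
Proof.
rewrite /strands orient_cat; last first.
  by rewrite size_crossing_strands size_crossing_bits size_tuple.
congr (_ ++ _); case: o => [[os /= /eqP eq_size] _].
elim: (crossings D) os eq_size => [|x xs IHxs] [|y os] //= [/IHxs eq_os].
by rewrite -/(orient _ _) /= eq_os.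
Qed.

Lemma crossing_bits_inj : injective crossing_bits.
Proof.
by elim=> [|[a b] os IHos] [|[c d] os'] //= [-> -> /IHos->].
Qed.

Lemma crossing_bits_negb os :
  map negb (crossing_bits os) = crossing_bits [seq (~~ y.1, ~~ y.2) | y <- os].
Proof. by elim: os => //= y os; rewrite /crossing_bits /= => ->. Qed.

(* The strands on which two coherent orientations agree meet every edge either
   twice or not at all. *)
Lemma connected_coherent (E : finType) (A B : seq (E * E)) :
    uniq (unzip1 (A ++ B)) -> uniq (unzip2 (A ++ B)) ->
    perm_eq (unzip1 A ++ unzip2 B) (unzip2 A ++ unzip1 B) ->
    (forall x y, connect (joined (A ++ B)) x y) ->
  A = [::] \/ B = [::].
Proof.
rewrite /unzip1 /unzip2 !map_cat !cat_uniq => /and3P[_ /hasPn AB1 _].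
move=> /and3P[_ /hasPn AB2 _] /perm_mem eqAB conn.
have A12 e : (e \in unzip1 A) = (e \in unzip2 A).
  have := eqAB e; rewrite !mem_cat => eq_e.
  apply/idP/idP => eA; move: eq_e; rewrite eA /=.
    by move/esym; case/orP => // /AB1; rewrite eA.
  by case/orP => // /AB2; rewrite eA.
have AB p : p \in A ++ B -> (p.1 \in unzip1 A) = (p.2 \in unzip1 A).
  rewrite mem_cat => /orP[] pP; rewrite [RHS]A12.
    by rewrite /unzip1 /unzip2 !map_f //.
  by rewrite A12 -A12 (negPf (AB1 _ (map_f _ pP))) (negPf (AB2 _ (map_f _ pP))).
have clA : closed (joined (A ++ B)) (mem (unzip1 A)).
  by move=> x y /orP[] /AB.
case: A B conn clA AB1 {eqAB AB2 A12 AB} => [|a A] [|b B] conn clA AB1;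
  [by left|by left|by right|].
have := closed_connect clA (conn a.1 b.1).
by rewrite [LHS]mem_head (negPf (AB1 _ (mem_head _ _))).
Qed.

(** Passing from [bs0] to [bs] reverses exactly the strands of [B], which exchanges their sources
    and targets. Counting with an arbitrary predicate yields permutations through [permP]. *)
Lemma orient_split (E : Type) (a : pred E) (P : seq (E * E)) bs0 bs :
    size bs0 = size P -> size bs = size P ->
  let agree := [seq y.1 == y.2 | y <- zip bs0 bs] in
  let A := mask agree (orient P bs0) in
  let B := mask (map negb agree) (orient P bs0) in
  [/\ count a (unzip1 (orient P bs)) = count a (unzip1 A ++ unzip2 B),
      count a (unzip2 (orient P bs)) = count a (unzip2 A ++ unzip1 B),
      count a (unzip1 (orient P bs0)) = count a (unzip1 (A ++ B))
    & count a (unzip2 (orient P bs0)) = count a (unzip2 (A ++ B))].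
Proof.
elim: P bs0 bs => [|p P IHP] [|b0 bs0] [|b bs] //= [eq0] [eq1].
have [] := IHP _ _ eq0 eq1; rewrite /unzip1 /unzip2 !map_cat !count_cat.
by case: b0 b => -[] /= -> -> -> ->; rewrite -/(orient P bs0); split; lia.
Qed.

(** By [connected_coherent], either no strand keeps its direction or no strand is reversed. *)
Lemma orientation_unique (E : finType) (P : seq (E * E)) bs0 bs :
    size bs0 = size P -> size bs = size P ->
    uniq (unzip1 (orient P bs0)) -> uniq (unzip2 (orient P bs0)) ->
    (forall x y, connect (joined (orient P bs0)) x y) ->
    perm_eq (unzip1 (orient P bs)) (unzip2 (orient P bs)) ->
  bs = bs0 \/ bs = map negb bs0.
Proof.
move=> size0 size1 uniq1 uniq2 conn perm.
pose agree := [seq y.1 == y.2 | y <- zip bs0 bs].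
pose A := mask agree (orient P bs0); pose B := mask (map negb agree) (orient P bs0).
have split a := orient_split a size0 size1.
have sz : size agree = size (orient P bs0).
  by rewrite [RHS]size_orient ?size0 // /agree size_map size1_zip size0 ?size1.
have perm0 : perm_eq (orient P bs0) (A ++ B).
  apply/permP => a; rewrite /A /B.
  elim: (agree) (orient _ _) sz => [|b m IHm] [|x s] //= [/IHm] IHs.
  by case: b => /=; rewrite !(IHs, count_cat) /=; lia.
have [] : A = [::] \/ B = [::].
- apply: connected_coherent.
  + by rewrite -(perm_uniq (perm_map _ perm0)).
  + by rewrite -(perm_uniq (perm_map _ perm0)).
  + apply/permP => a; have [<- <- _ _] := split a.
    exact/permP.
  + by move=> x y; rewrite -(eq_connect (e := joined (orient P bs0))) // => z t;
      rewrite /joined !(perm_mem perm0).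
- move/(congr1 size); rewrite size_mask // => /eqP; rewrite -leqn0 leqNgt -has_count.
  rewrite has_map => agreeF; right; rewrite -size1 in size0.
  elim: bs0 bs size0 agreeF {A B split sz perm0 agree uniq1 uniq2 conn perm size1}
    => [|b0 bs0 IHbs] [|b bs] //= [/IHbs IH]; rewrite negb_or => /andP[neq /IH->].
  by case: b0 b neq => -[].
- move/(congr1 size); rewrite size_mask; last by rewrite size_map.
  move/eqP; rewrite -leqn0 leqNgt -has_count !has_map => agreeF.
  left; rewrite -size1 in size0.
  elim: bs0 bs size0 agreeF {A B split sz perm0 agree uniq1 uniq2 conn perm size1}
    => [|b0 bs0 IHbs] [|b bs] //= [/IHbs IH]; rewrite negb_or => /andP[neq /IH->].
  by case: b0 b neq => -[].
Qed.

(** * The standard orientation of [K L] *)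

Section Writhe.

Variable L : labels.

(** At the vertex the last side of a leg goes up and the first side goes down; strands change sides
    at each crossing, so the direction seen on a given side alternates with the level. *)
Definition goes_up (j : 'I_6) (k : nat) (left : bool) : bool :=
  (left != odd j) (+) odd k.

(** For a label that is not positive, [leg_crossing] lists the over-strand from upper right to lower
    left, whence the negation. *)
Definition leg_bits (j : 'I_6) (k : nat) : bool * bool :=
  if 0 < leg_label L j then (goes_up j k true, goes_up j k false)
  else (goes_up j k false, ~~ goes_up j k true).

Definition K_crossing_bits : seq (bool * bool) :=
  flatten [seq [seq leg_bits j k | k <- iota 0 (leg_size L j)] | j <- enum 'I_6].

(** Strands cross [C] from the last side of a leg to the next leg, and run against the listed
    direction at the vertices. *)
Definition K_join_bits : seq bool :=
  flatten [seq [:: true; false] | j <- enum 'I_6].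

Lemma size_K_crossing_bits : size K_crossing_bits = size (crossings (K L)).
Proof.
rewrite /K_crossing_bits /=; elim: (enum _) => //= j legs IHlegs.
by rewrite !size_cat IHlegs !size_map.
Qed.

Lemma size_K_join_bits : size K_join_bits = size (joins (K L)).
Proof. by rewrite /K_join_bits /=; elim: (enum _) => //= j legs ->. Qed.

Definition K_directions : directions (K L) :=
  (Tuple (introT eqP size_K_crossing_bits), Tuple (introT eqP size_K_join_bits)).

Definition K_oriented : seq (edge L * edge L) := directed_strands K_directions.

Lemma K_oriented_strand j k s : (k < leg_size L j)%N ->
  (if goes_up j k s then (mk_edge L j k s, mk_edge L j k.+1 (~~ s))
   else (mk_edge L j k.+1 (~~ s), mk_edge L j k s)) \in K_oriented.
Proof.
move=> k_lt; rewrite mem_cat; apply/orP; left => /=.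
have : j \in enum 'I_6 by rewrite mem_enum.
rewrite /K_crossing_bits; elim: (enum _) => //= i legs IHlegs.
rewrite inE zip_cat ?size_map // map_cat flatten_cat mem_cat => /predU1P[<-|/IHlegs->];
  last by rewrite orbT.
apply/orP; left; rewrite zip_map -map_comp; apply/flatten_mapP; exists k.
  by rewrite mem_iota.
rewrite /= /leg_crossing /leg_bits !inE /directed.
case: (0 < leg_label L j) => /=; case: s {IHlegs};
  case: (goes_up j k true) => /=; case: (goes_up j k false) => /=;
  by rewrite eqxx ?orbT.
Qed.

Lemma K_oriented_joins j :
  let top := (last_edge L j (leg_size L j), first_edge L (j + 1) (leg_size L (j + 1))) in
  let vertex := (first_edge L (j + 2%:R) 0, last_edge L j 0) in
  top \in K_oriented /\ vertex \in K_oriented.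
Proof.
suff joinP p : p \in [:: (last_edge L j (leg_size L j),
                          first_edge L (j + 1) (leg_size L (j + 1)));
                         (first_edge L (j + 2%:R) 0, last_edge L j 0)] ->
    p \in K_oriented.
  by split; apply: joinP; rewrite !inE eqxx ?orbT.
move=> pP; rewrite mem_cat; apply/orP; right => /=.
have : j \in enum 'I_6 by rewrite mem_enum.
rewrite /K_join_bits; elim: (enum _) => //= i legs IHlegs.
rewrite !inE => /predU1P[<-|/IHlegs->]; last by rewrite !orbT.
by move: pP; rewrite !inE => /orP[]->; rewrite ?orbT.
Qed.

(** A leg with n crossings has 2n strands and two joins, for 2(n + 1) edges. With this count,
    coherence follows once every edge occurs as a source and as a target. *)
Lemma size_K_oriented : size K_oriented = #|edge L|.
Proof.
rewrite /K_oriented directed_strandsE size_orient; last exact: size_strands.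
rewrite size_cat size_crossing_strands card_tagged enum_legs6 /= enum_legs6 /=.
rewrite !size_cat !size_map !size_iota !card_prod !card_ord card_bool /=; lia.
Qed.

Hypothesis even_legs : forall j, ~~ odd (leg_size L j).

Lemma goes_upS j k s : goes_up j k.+1 (~~ s) = goes_up j k s.
Proof. by rewrite /goes_up /=; case: s (odd j) (odd k) => -[] []. Qed.

Lemma K_oriented_source e : e \in unzip1 K_oriented.
Proof.
rewrite -(mk_edgeK e); move: (tag e) (level e) (on_left e) (level_le e) => j k s k_le.
have strandP p : p \in K_oriented -> p.1 \in unzip1 K_oriented by apply: map_f.
have [up|down] := boolP (goes_up j k s).
  have [k_lt|k_ge] := ltnP k (leg_size L j).
    by have := strandP _ (K_oriented_strand s k_lt); rewrite up.
  have k_top : k = leg_size L j by apply/eqP; rewrite eqn_leq k_le.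
  (* With an even number of crossings each strand ends on the side where it began, so the upward
     edge at the top is on the last side. *)
  have -> : s = ~~ odd j.
    by move: up; rewrite /goes_up k_top (negPf (even_legs j)); case: s (odd j) => -[].
  by rewrite k_top; have [/strandP] := K_oriented_joins j.
case: k => [|k] in k_le down *.
  have -> : s = odd j by move: down; rewrite /goes_up; case: s (odd j) => -[].
  by have [_ /strandP] := K_oriented_joins (j - 2%:R); rewrite subrK.
have := strandP _ (K_oriented_strand (~~ s) k_le).
by rewrite -goes_upS negbK (negPf down).
Qed.

Lemma K_oriented_target e : e \in unzip2 K_oriented.
Proof.
rewrite -(mk_edgeK e); move: (tag e) (level e) (on_left e) (level_le e) => j k s k_le.
have strandP p : p \in K_oriented -> p.2 \in unzip2 K_oriented by apply: map_f.
have [up|down] := boolP (goes_up j k s).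
  case: k => [|k] in k_le up *.
    have -> : s = ~~ odd j by move: up; rewrite /goes_up; case: s (odd j) => -[].
    by have [_ /strandP] := K_oriented_joins j.
  have := strandP _ (K_oriented_strand (~~ s) k_le).
  by rewrite -goes_upS negbK up.
have [k_lt|k_ge] := ltnP k (leg_size L j).
  by have := strandP _ (K_oriented_strand s k_lt); rewrite (negPf down).
have k_top : k = leg_size L j by apply/eqP; rewrite eqn_leq k_le.
have -> : s = odd j.
  by move: down; rewrite /goes_up k_top (negPf (even_legs j)); case: s (odd j) => -[].
by have [/strandP] := K_oriented_joins (j - 1); rewrite subrK k_top.
Qed.

Lemma uniq_K_oriented : uniq (unzip1 K_oriented) /\ uniq (unzip2 K_oriented).
Proof.
split; apply: (leq_size_uniq (enum_uniq (edge L))).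
- by move=> e _; apply: K_oriented_source.
- by rewrite size_map size_K_oriented cardE.
- by move=> e _; apply: K_oriented_target.
- by rewrite size_map size_K_oriented cardE.
Qed.

Lemma orientation_K : orientation K_directions.
Proof.
have [uniq1 uniq2] := uniq_K_oriented; apply: uniq_perm => // e.
by rewrite K_oriented_source K_oriented_target.
Qed.

(** This is where even labels make the link a knot: every edge is linked to the bottom of its leg,
    and the bottoms are linked around [C]. *)
Lemma connected_K x y : connect (joined K_oriented) x y.
Proof.
have sym := connect_joined_sym K_oriented.
have strandP j k s : (k < leg_size L j)%N ->
    connect (joined K_oriented) (mk_edge L j k s) (mk_edge L j k.+1 (~~ s)).
  move=> /(K_oriented_strand s); case: ifP => _ pP; first exact: connect_join.
  exact: connect_join_sym.
have bottom j k s : (k <= leg_size L j)%N ->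
    connect (joined K_oriented) (mk_edge L j k s) (mk_edge L j 0 (s (+) odd k)).
  elim: k s => [|k IHk] s k_le; first by rewrite addbF connect0.
  have := strandP j k (~~ s) k_le; rewrite negbK sym => /connect_trans; apply.
  have := IHk (~~ s) (ltnW k_le); rewrite /=.
  by have -> : ~~ s (+) odd k = s (+) ~~ odd k by case: s (odd k) => -[].
have top_next j : connect (joined K_oriented) (last_edge L j 0) (first_edge L (j + 1) 0).
  have top i s : connect (joined K_oriented)
      (mk_edge L i (leg_size L i) s) (mk_edge L i 0 s).
    by have := bottom i _ s (leqnn _); rewrite (negPf (even_legs i)) addbF.
  have := top j (~~ odd j); rewrite sym => /connect_trans; apply.
  apply: connect_trans (top (j + 1) (odd (j + 1)%R)).
  by apply: connect_join; have [] := K_oriented_joins j.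
(* The last side of leg [j] leads both across [C] to leg [j + 1] and through the vertex to leg
   [j + 2], so consecutive first sides are linked. *)
have first_next j : connect (joined K_oriented)
    (first_edge L (j + 1) 0) (first_edge L (j + 2%:R) 0).
  apply: (@connect_trans _ _ (last_edge L j 0)); first by rewrite sym.
  by apply: connect_join_sym; have [] := K_oriented_joins j.
have first_all n (n_lt : (n < 6)%N) :
    connect (joined K_oriented) (first_edge L ord0 0) (first_edge L (Ordinal n_lt) 0).
  elim: n n_lt => [|n IHn] n_lt.
    by have -> : Ordinal n_lt = ord0 by apply/val_inj.
  apply: connect_trans (IHn (ltnW n_lt)) _; set j := Ordinal _.
  have -> : Ordinal n_lt = (j - 1) + 2%:R.
    apply/val_inj; rewrite /= -/(nat_of_ord 1) /=; lia.
  have {1}-> : j = (j - 1) + 1 by rewrite subrK.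
  exact: first_next.
have root e : connect (joined K_oriented) (first_edge L ord0 0) e.
  rewrite -(mk_edgeK e) sym; apply: connect_trans (bottom _ _ _ (level_le e)) _.
  rewrite sym; move: (_ (+) _) (tag e) => s j.
  have firstP i : connect (joined K_oriented) (first_edge L ord0 0) (first_edge L i 0).
    by case: i => n n_lt; apply: first_all.
  have [-> //|s_neq] := eqVneq s (odd j); first exact: firstP.
  have -> : s = ~~ odd j by case: s (odd j) s_neq => -[].
  by apply: connect_trans (firstP (j + 1)) _; rewrite sym; apply: top_next.
by rewrite -(same_connect sym (root x)).
Qed.

(** The two strands of a leg are antiparallel at every level, so each crossing has the sign of its
    label. *)
Lemma sum_crossing_sign_K :
  \sum_(s <- K_crossing_bits) crossing_sign s = \sum_(j <- legs6) leg_label L j.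
Proof.
rewrite /K_crossing_bits big_flatten big_map enum_legs6; apply: eq_bigr => j _.
rewrite big_map.
rewrite (eq_bigr (fun=> if 0 < leg_label L j then 1 else -1)); last first.
  move=> k _; rewrite /leg_bits /crossing_sign /goes_up.
  by case: (0 < leg_label L j); case: (odd j) (odd k) => -[].
rewrite big_const_seq count_predT size_iota iter_addr_0 /leg_size.
by case: (leg_label L j) => [[|n]|n] //=; lia.
Qed.

Lemma writhe_K : writhe (K L) = \sum_(j <- legs6) leg_label L j.
Proof.
rewrite /writhe; case: pickP => [o|/(_ K_directions)]; last by rewrite orientation_K.
rewrite /orientation directed_strandsE => oP.
have [uniq1 uniq2] := uniq_K_oriented; have conn := connected_K.
rewrite /K_oriented directed_strandsE in uniq1 uniq2 conn.
have sizeE (o' : directions (K L)) : size (bits o') = size (strands (K L)).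
  by rewrite -size_strands.
have := orientation_unique (sizeE _) (sizeE o) uniq1 uniq2 conn oP.
rewrite -sum_crossing_sign_K.
have eq_bits os bs : size os = size (o.1 : seq (bool * bool)) ->
    bits o = crossing_bits os ++ bs -> (o.1 : seq (bool * bool)) = os.
  move=> eq_size /eqP; rewrite eqseq_cat ?size_crossing_bits ?eq_size //.
  by case/andP=> /eqP/crossing_bits_inj.
have size1 : size K_crossing_bits = size (o.1 : seq (bool * bool)).
  by rewrite size_tuple size_K_crossing_bits.
case; first by move/eq_bits->.
(* The orientation picked may be the reverse one; negating both bits of a crossing preserves its
   sign. *)
rewrite /bits map_cat crossing_bits_negb => /eq_bits->; last by rewrite size_map.
rewrite big_map; apply: eq_bigr => -[[] []] //.
Qed.

End Writhe.

(** * Transposing the labels of a row *)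

Lemma writhe_K_even (p q r a b c : int) :
    (2 %| p)%Z -> (2 %| q)%Z -> (2 %| r)%Z ->
    (2 %| a)%Z -> (2 %| b)%Z -> (2 %| c)%Z ->
  writhe (K ((p, q, r), (a, b, c))) = p + q + r + (a + b + c).
Proof.
move=> p2 q2 r2 a2 b2 c2; rewrite writhe_K.
  by rewrite /legs6 !big_cons big_nil /=; ring.
move=> j; rewrite -dvdn2; move: j; rewrite /leg_size.
by case=> -[|[|[|[|[|[|]]]]]].
Qed.

Lemma Jones_eq_bracket (E F : finType) (D : diagram E) (D' : diagram F) :
  writhe D = writhe D' -> Jones D = Jones D' <-> bracket D = bracket D'.
Proof.
move=> eq_w; rewrite /Jones eq_w; split=> [|-> //]; apply: mulfI.
by rewrite expfz_neq0 // oppr_eq0 expf_neq0 // varA_neq0.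
Qed.

Theorem lemma4p7 (p q r a b c a' b' c' : int)
  (p_even : (2 %| p)%Z) (q_even : (2 %| q)%Z) (r_even : (2 %| r)%Z)
  (a_even : (2 %| a)%Z) (b_even : (2 %| b)%Z) (c_even : (2 %| c)%Z)
  (transposed : (a', b', c') = (b, a, c) \/ (a', b', c') = (a, c, b) \/
                (a', b', c') = (c, b, a)) :
  Jones (K ((p, q, r), (a, b, c))) = Jones (K ((p, q, r), (a', b', c'))) <->
  D3_symmetric ((p, q, r), (a, b, c)) ((p, q, r), (a', b', c')).
Proof.
have rot p0 q0 r0 a0 b0 c0 :
    D3_symmetric ((p0, q0, r0), (a0, b0, c0)) ((q0, r0, p0), (b0, c0, a0)).
  exact/rst_step/D3_rotation1.
have refl p0 q0 r0 a0 b0 c0 :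
    D3_symmetric ((p0, q0, r0), (a0, b0, c0)) ((p0, r0, q0), (c0, b0, a0)).
  exact/rst_step/D3_reflection.
have [eq_w sym] : writhe (K ((p, q, r), (a', b', c'))) = p + q + r + (a + b + c) /\
    (bracket (K ((p, q, r), (a, b, c))) = bracket (K ((p, q, r), (a', b', c'))) ->
     D3_symmetric ((p, q, r), (a, b, c)) ((p, q, r), (a', b', c'))).
  case: transposed => [|[]] [-> -> ->]; split;
    try (rewrite writhe_K_even //; ring).
  (* If [p = r], a reflection followed by a rotation restores the upper row and swaps [a] and
     [b]. *)
  - case/bracket_K_swap=> ->; last exact: rst_refl.
    by apply: rst_trans (refl _ _ _ _ _ _) _; apply: rot.
  (* Rotations bring the other two transpositions to the first two columns. *)
  - rewrite (bracket_K_D3 (rot p q r a b c)) (bracket_K_D3 (rot p q r a c b)).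
    case/bracket_K_swap=> ->; last exact: rst_refl.
    apply: rst_trans (refl _ _ _ _ _ _) _; apply: rst_trans (rot _ _ _ _ _ _) _.
    exact: rot.
  - rewrite -(bracket_K_D3 (rot r p q c a b)) -(bracket_K_D3 (rot r p q a c b)).
    case/bracket_K_swap=> ->; last exact: rst_refl.
    exact: refl.
rewrite Jones_eq_bracket; last by rewrite eq_w writhe_K_even.
by split=> // /bracket_K_D3.
Qed.
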